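(* Let $m$, $n$ and $q$ be positive integers. Then \[ \sum_{k = 1}^\infty (-1)^{nk-1}\,\frac{\prod_{j=1}^{m-1} F_{nk+jnq}}{\prod_{j=0}^{m} L_{nk+jnq}} = \frac{1}{2F_{mnq}}\sum_{k=1}^{q}\prod_{j=0}^{m-1}\frac{F_{nk+jnq}}{L_{nk+jnq}} - \frac{q}{2F_{mnq}\sqrt{5^m}}, \] so that, if $n$ is even, \[ \sum_{k = 1}^\infty \frac{\prod_{j=1}^{m-1} F_{nk+jnq}}{\prod_{j=0}^{m} L_{nk+jnq}} = \frac{q}{2F_{mnq}\sqrt{5^m}} - \frac{1}{2F_{mnq}}\sum_{k=1}^{q}\prod_{j=0}^{m-1}\frac{F_{nk+jnq}}{L_{nk+jnq}}, \] and, if $n$ is odd, \[ \sum_{k = 1}^\infty (-1)^{k-1}\,\frac{\prod_{j=1}^{m-1} F_{nk+jnq}}{\prod_{j=0}^{m} L_{nk+jnq}} = \frac{1}{2F_{mnq}}\sum_{k=1}^{q}\prod_{j=0}^{m-1}\frac{F_{nk+jnq}}{L_{nk+jnq}} - \frac{q}{2F_{mnq}\sqrt{5^m}}. \]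
   Context: The Fibonacci numbers are defined by $F_0=0$, $F_1=1$, $F_n=F_{n-1}+F_{n-2}$, and the Lucas numbers by $L_0=2$, $L_1=1$, $L_n=L_{n-1}+L_{n-2}$. Infinite sums are limits of partial sums. Empty products equal $1$ (in particular $\prod_{j=1}^{0}=1$). *)

(* Defs.v *)
From mathcomp Require Import all_boot all_order all_algebra.
From mathcomp Require Import all_classical all_reals all_analysis.

Set Implicit Arguments.
Unset Strict Implicit.
Unset Printing Implicit Defensive.

Fixpoint fib (n : nat) : nat :=
  match n with
  | 0 => 0
  | 1 => 1
  | (n''.+1 as n').+1 => fib n' + fib n''
  end.

Fixpoint lucas (n : nat) : nat :=
  match n with
  | 0 => 2
  | 1 => 1
  | (n''.+1 as n').+1 => lucas n' + lucas n''
  end.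

(* Main.v *)
(** Put [P k := \prod_(0 <= j < m) F (n k + j n q) / L (n k + j n q)]. The
    identity [F_a L_(a+c) - F_(a+c) L_a = - 2 (-1)^a F_c] with [a = n k] and
    [c = m n q] shows that the [k]-th term of the alternating series is
    [(P k - P (k + q)) / (2 F_(m n q))], so the partial sums telescope with
    step [q]. Since [L_i^2 - 5 F_i^2 = 4 (-1)^i], the ratio [F_i / L_i] tends
    to [1 / sqrt 5], hence [P k] tends to [1 / sqrt (5 ^ m)]. *)

Require Import Defs.
From mathcomp Require Import all_boot all_order all_algebra.
From mathcomp Require Import all_classical all_reals all_analysis.
From mathcomp Require Import ring.

Import Order.TTheory GRing.Theory Num.Theory.
Import numFieldNormedType.Exports.

Local Open Scope classical_set_scope.
Local Open Scope ring_scope.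

Lemma fibSS (i : nat) : fib i.+2 = (fib i.+1 + fib i)%N.
Proof. by []. Qed.

Lemma lucasSS (i : nat) : lucas i.+2 = (lucas i.+1 + lucas i)%N.
Proof. by []. Qed.

Lemma fib_gt0 (i : nat) : (0 < fib i.+1)%N.
Proof. by elim: i => // i IH; rewrite fibSS addn_gt0 IH. Qed.

(** Stated without subtraction so as to stay in [nat]. The recurrence has order two, so the
    induction carries two consecutive indices. *)
Lemma lucas_fib (i : nat) : (lucas i + fib i = 2 * fib i.+1)%N.
Proof.
suff [] : (lucas i + fib i = 2 * fib i.+1 /\
           lucas i.+1 + fib i.+1 = 2 * fib i.+2)%N by [].
elim: i => // i [IH1 IH2]; split=> //.
by rewrite (fibSS i.+1) lucasSS mulnDr -IH1 -IH2 fibSS addnACA.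
Qed.

Lemma leq_fibS (i : nat) : (fib i <= fib i.+1)%N.
Proof. by case: i => // i; rewrite fibSS leq_addr. Qed.

Lemma fib_le_lucas (i : nat) : (fib i.+1 <= lucas i)%N.
Proof.
by rewrite -(leq_add2r (fib i)) lucas_fib mul2n -addnn leq_add2l leq_fibS.
Qed.

Lemma lucas_gt0 (i : nat) : (0 < lucas i)%N.
Proof. exact: leq_trans (fib_gt0 i) (fib_le_lucas i). Qed.

(** A crude growth bound, enough to force the inverses of the Lucas numbers to tend to 0. *)
Lemma leq_lucas (i : nat) : (i <= lucas i)%N.
Proof.
elim: i => // -[|i] // IH.
by rewrite lucasSS -addn1 leq_add // lucas_gt0.
Qed.

Section FibLucasRing.
Variable R : comPzRingType.
Implicit Types a c i : nat.

Lemma lucasE i : (lucas i)%:R = 2 * (fib i.+1)%:R - (fib i)%:R :> R.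
Proof. by rewrite -natrM -lucas_fib natrD addrK. Qed.

(** The quadratic form [x^2 - x y - y^2] changes sign under [(x, y) -> (x + y, x)], which is one
    Fibonacci step. *)
Lemma cassini i :
  (fib i.+1)%:R ^+ 2 - (fib i.+1)%:R * (fib i)%:R - (fib i)%:R ^+ 2
    = (-1) ^+ i :> R.
Proof.
elim: i => [|i IH]; first by rewrite /=; ring.
by rewrite [RHS]exprS -IH fibSS natrD; ring.
Qed.

Lemma lucas_sqr i :
  (lucas i)%:R ^+ 2 = 5 * (fib i)%:R ^+ 2 + 4 * (-1) ^+ i :> R.
Proof. by rewrite -cassini lucasE; ring. Qed.

(** For fixed [a], the difference [D] of the two sides satisfies the Fibonacci recurrence in [c], so
    it vanishes once [D 0] and [D 1] do; the case [c = 1] is Cassini's identity. *)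
Lemma fib_lucas_cross a c :
  (fib a)%:R * (lucas (a + c))%:R - (fib (a + c))%:R * (lucas a)%:R
    = - (2 * (-1) ^+ a * (fib c)%:R) :> R.
Proof.
pose D c : R :=
  (fib a)%:R * (lucas (a + c))%:R - (fib (a + c))%:R * (lucas a)%:R
    + 2 * (-1) ^+ a * (fib c)%:R.
suff [D0 _] : D c = 0 /\ D c.+1 = 0 by apply/eqP; rewrite -addr_eq0; apply/eqP.
elim: c => [|c [IH1 IH2]]; split=> //; rewrite /D.
- by rewrite addn0 /=; ring.
- by rewrite addn1 -cassini !lucasE fibSS natrD /=; ring.
- rewrite -[RHS]addr0 -{1}IH1 -IH2 /D !addnS lucasSS !fibSS !natrD; ring.
Qed.

End FibLucasRing.

(** After the negative terms change sides, both sides split the sum of [P] over [1..N+q], once at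
    [N] and once at [q]. The tail has a fixed number [q] of terms, so its limit in [N] can be taken
    termwise. *)
Lemma telescope_sum_step (V : zmodType) (P : nat -> V) (q N : nat) :
  \sum_(1 <= k < N.+1) (P k - P (k + q)%N)
    = \sum_(1 <= k < q.+1) P k - \sum_(0 <= i < q) P (i + N.+1)%N.
Proof.
have shift a b : \sum_(0 <= i < a) P (i + b.+1)%N
    = \sum_(b.+1 <= k < (b + a).+1) P k.
  by rewrite -{2}[b.+1]add0n big_addn subSS addKn.
apply/eqP; rewrite sumrB subr_eq addrAC eq_sym subr_eq.
rewrite [X in _ + X == _](_ : _ = \sum_(0 <= i < N) P (i + q.+1)%N); last first.
  by rewrite big_add1; apply: eq_bigr => i _; rewrite addSnnS.
by rewrite !shift -!big_cat_nat ?ltnS ?leq_addr // addnC.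
Qed.

Lemma cvg_fib_lucas (R : realType) :
  ((fib i)%:R / (lucas i)%:R) @[i --> \oo] --> ((Num.sqrt 5)^-1 : R).
Proof.
have L0 i : (lucas i)%:R != 0 :> R by rewrite pnatr_eq0 -lt0n lucas_gt0.
(* The ratio is nonnegative, hence the square root of its square; the limit then follows from
   continuity of the root. *)
have ratioE i : (fib i)%:R / (lucas i)%:R
    = Num.sqrt (5^-1 - 4 / 5 * ((-1) ^+ i / (lucas i)%:R ^+ 2)) :> R.
  rewrite -[LHS]ger0_norm ?divr_ge0 // -sqrtr_sqr; congr Num.sqrt.
  have -> : (-1) ^+ i = ((lucas i)%:R ^+ 2 - 5 * (fib i)%:R ^+ 2) / 4 :> R.
    by rewrite lucas_sqr; field.
  by field; exact: L0.
have small : (-1) ^+ i / (lucas i)%:R ^+ 2 @[i --> \oo] --> (0 : R).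
  have LV : (lucas i)%:R^-1 @[i --> \oo] --> (0 : R).
    apply/gtr0_cvgV0; first by near=> i; rewrite ltr0n lucas_gt0.
    apply/cvgrnyP/cvgnyPge => A; near=> i.
    by apply: leq_trans (leq_lucas i); near: i; exact: nbhs_infty_ge.
  apply: norm_cvg0; under eq_fun do
    rewrite normrM normrX normrN1 expr1n mul1r normfV normrX normr_nat -exprVn.
  by rewrite -(mulr0 (0 : R)); exact: cvgM.
have arg : 5^-1 - 4 / 5 * ((-1) ^+ i / (lucas i)%:R ^+ 2) @[i --> \oo]
    --> (5^-1 - 4 / 5 * 0 : R).
  by apply: cvgB; [exact: cvg_cst | apply: cvgM small; exact: cvg_cst].
under eq_fun do rewrite ratioE.
rewrite -sqrtrV //; apply: continuous_cvg; first exact: sqrt_continuous.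
by rewrite mulr0 subr0 in arg.
Unshelve. all: by end_near. Qed.

Theorem theorem2p12 (R : realType) (m n q : nat)
    (hm : (0 < m)%N) (hn : (0 < n)%N) (hq : (0 < q)%N) :
  let F (i : nat) : R := (fib i)%:R in
  let L (i : nat) : R := (lucas i)%:R in
  let term (k : nat) : R :=
    (\prod_(1 <= j < m) F (n * k + j * n * q)%N) /
    (\prod_(0 <= j < m.+1) L (n * k + j * n * q)%N) in
  let A : R :=
    1 / (2 * F (m * n * q)%N) *
    \sum_(1 <= k < q.+1)
      \prod_(0 <= j < m)
        (F (n * k + j * n * q)%N / L (n * k + j * n * q)%N) in
  let B : R := q%:R / (2 * F (m * n * q)%N * Num.sqrt (5 ^+ m)) in
  [/\ (\sum_(1 <= k < N.+1) ((-1) ^+ (n * k - 1)%N * term k))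
        @[N --> \oo] --> A - B,
      ~~ odd n ->
        (\sum_(1 <= k < N.+1) term k) @[N --> \oo] --> B - A
    & odd n ->
        (\sum_(1 <= k < N.+1) ((-1) ^+ (k - 1)%N * term k))
        @[N --> \oo] --> A - B].
Proof.
move=> F L term A B.
have F0 : F (m * n * q)%N != 0.
  have : (0 < m * n * q)%N by rewrite !muln_gt0 hm hn hq.
  by rewrite /F; case: (m * n * q)%N => // i _; rewrite pnatr_eq0 -lt0n fib_gt0.
have L0 i : L i != 0 by rewrite pnatr_eq0 -lt0n lucas_gt0.
pose G i : R := F i / L i.
pose P k : R := \prod_(0 <= j < m) G (n * k + j * n * q)%N.
have termE k : (0 < k)%N ->
    (-1) ^+ (n * k - 1) * term k = (P k - P (k + q)%N) / (2 * F (m * n * q)%N).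
  move=> k0.
  have nk0 : (0 < n * k)%N by rewrite muln_gt0 hn.
  (* Shifting [k] by [q] amounts to shifting [j] by 1, so [P k] and [P (k + q)] share the factors
     with [0 < j < m]. *)
  have PqE : P (k + q)%N = \prod_(1 <= j < m.+1) G (n * k + j * n * q)%N.
    rewrite big_add1; apply: eq_bigr => j _.
    by congr G; rewrite mulnDr mulSn mulnDl addnA.
  have cross := @fib_lucas_cross R (n * k) (m * n * q).
  have -> : (-1) ^+ (n * k - 1) = - (-1) ^+ (n * k) :> R.
    by rewrite -[in RHS](subnK nk0) exprD expr1 mulrN1 opprK.
  (* With the sign written this way and the factors [j = 0] and [j = m] split off, only a rational
     identity remains. *)
  have -> : (-1) ^+ (n * k) = (F (n * k + m * n * q)%N * L (n * k)%N
      - F (n * k)%N * L (n * k + m * n * q)%N) / (2 * F (m * n * q)%N) :> R.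
    rewrite -opprB cross opprK -mulrA mulrCA mulfK //.
    by apply: mulf_neq0 F0; rewrite pnatr_eq0.
  rewrite PqE /P /term big_nat_recr // [\prod_(0 <= j < m) G _]big_ltn //.
  rewrite [\prod_(0 <= j < m) L _]big_ltn // big_nat_recr //= !mul0n addn0.
  rewrite /G !prodf_div.
  have Y0 : \prod_(1 <= j < m) L (n * k + j * n * q)%N != 0.
    by rewrite prodf_seq_neq0; apply/allP => j _; exact: L0.
  by field; rewrite Y0 F0 !L0.
have P_cvg : P k @[k --> \oo] --> (Num.sqrt (5 ^+ m))^-1.
  (* The limit is put in product form so that convergence can be checked factor by factor. *)
  have -> : (Num.sqrt (5 ^+ m))^-1 = \prod_(0 <= j < m) (Num.sqrt 5)^-1 :> R.
    rewrite prodr_const_nat subn0 exprVn; congr _^-1.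
    by rewrite -{1}(@sqr_sqrtr R 5) // -exprM mulnC exprM sqrtr_sqr ger0_norm //.
  apply: cvg_big => [|j _]; first exact: mul_continuous.
  apply: (cvg_comp _ _ _ (cvg_fib_lucas R)).
  apply/cvgnyPge => a; near=> k.
  apply: leq_trans (leq_addr _ _); apply: leq_trans (leq_pmull _ hn).
  by near: k; exact: nbhs_infty_ge.
have main : (\sum_(1 <= k < N.+1) ((-1) ^+ (n * k - 1)%N * term k))
    @[N --> \oo] --> A - B.
  have sumE N : \sum_(1 <= k < N.+1) ((-1) ^+ (n * k - 1)%N * term k)
      = (2 * F (m * n * q)%N)^-1 * (\sum_(1 <= k < q.+1) P k
          - \sum_(0 <= i < q) P (i + N.+1)%N).
    rewrite -telescope_sum_step mulr_sumr; apply: eq_big_nat => k /andP[k0 _].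
    by rewrite termE // mulrC.
  under eq_fun do rewrite sumE.
  (* The factor [q] in [B] counts the [q] tail terms, each tending to the limit of [P]. *)
  have -> : A - B = (2 * F (m * n * q)%N)^-1 * (\sum_(1 <= k < q.+1) P k
      - \sum_(0 <= i < q) (Num.sqrt (5 ^+ m))^-1).
    rewrite sumr_const_nat subn0 mulrBr /A div1r; congr (_ - _).
    by rewrite /B invfM mulrCA [q%:R * _]mulr_natl.
  apply: cvgM; first exact: cvg_cst.
  apply: cvgB; first exact: cvg_cst.
  apply: cvg_big => [|i _]; first exact: add_continuous.
  apply: (cvg_comp _ _ _ P_cvg); apply/cvgnyPge => a; near=> N.
  apply: leq_trans (leq_addl _ _); apply: leqW.
  by near: N; exact: nbhs_infty_ge.
split=> // n_parity.
(* For even [n], the exponent [n * k - 1] is odd whenever [k > 0], so every sign is -1. *)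
- have sumN N : \sum_(1 <= k < N.+1) term k
      = - \sum_(1 <= k < N.+1) ((-1) ^+ (n * k - 1)%N * term k).
    rewrite -sumrN; apply: eq_big_nat => k /andP[k0 _].
    rewrite -signr_odd oddB ?muln_gt0 ?hn // oddM (negbTE n_parity) /=.
    by rewrite expr1 mulN1r opprK.
  by under eq_fun do rewrite sumN; rewrite -opprB; exact: cvgN.
(* For odd [n] and [k > 0], [n * k - 1] and [k - 1] have the same parity. *)
- have signE N : \sum_(1 <= k < N.+1) ((-1) ^+ (k - 1)%N * term k)
      = \sum_(1 <= k < N.+1) ((-1) ^+ (n * k - 1)%N * term k).
    apply: eq_big_nat => k /andP[k0 _]; congr (_ * _).
    rewrite -signr_odd -[RHS]signr_odd !oddB ?muln_gt0 ?hn //.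
    by rewrite oddM n_parity.
  by under eq_fun do rewrite signE.
Unshelve. all: by end_near. Qed.
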